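(* Let $S=\{x\in\mathbb{R}^n\mid h_i^Tx\le b_i,\ i=1,\dots,r\}$, $U_{0,A}=\{A\in\mathbb{R}^{n\times n}\mid\mathrm{Tr}(V_j^TA)\le v_j,\ j=1,\dots,s\}$, and $U_{0,g}=\{g:\mathbb{R}^n\to\mathbb{R}^n\mid\|g(x)\|_\infty\le\gamma\|x\|_p^d\ \ \forall x\in S\}$, where $p\ge1$ is either $+\infty$ or a rational number, $\gamma>0$, and $d$ is a nonnegative integer. Let $f_\star(x)=A_\star x+g_\star(x)$ with $A_\star\in U_{0,A}$ and $g_\star\in U_{0,g}$. Let $x_1,\dots,x_k\in\mathbb{R}^n$, $y_j=f_\star(x_j)$, and $U_{k,A}=\{A\in U_{0,A}\mid\|Ax_j-y_j\|_\infty\le\gamma\|x_j\|_p^d,\ j=1,\dots,k\}$. Let $c\in\mathbb{R}^n$. Then the problem $$\min_x\ c^Tx\quad\text{s.t. } x\in S,\quad f(x)\in S\ \ \text{for all } f\in\{x\mapsto Ax+g(x)\mid A\in U_{k,A},\ g\in U_{0,g}\}$$ can be reformulated as a second-order cone program.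
   Context: Setting: an unknown nonlinear system $x_{t+1}=f_\star(x_t)$ consisting of an unknown linear part and an unknown nonlinear part of bounded growth on $S$; $(x_j,y_j)$ are observed one-step transitions. *)

(* Defs.v *)
From HB Require Import structures.
From mathcomp Require Import all_boot all_order all_algebra.
From mathcomp Require Import all_classical all_reals.
From mathcomp Require Import exp.
Set Implicit Arguments. Unset Strict Implicit. Unset Printing Implicit Defensive.
Import Order.TTheory GRing.Theory Num.Theory.
Local Open Scope ring_scope.

Inductive pexp := PInf | PRat of rat.

Section Defs.
Variable R : realType.

Definition norm_inf n (x : 'cV[R]_n) : R := \big[Num.max/0]_(i < n) `|x i 0|.

Definition norm_p n (p : pexp) (x : 'cV[R]_n) : R :=
  match p with
  | PInf => norm_inf x
  | PRat q => powR (\sum_(i < n) powR `|x i 0| (ratr q)) ((ratr q)^-1)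
  end.

Definition pexp_ok (p : pexp) : Prop :=
  match p with PInf => True | PRat q => 1 <= q end.

Definition norm2 n (x : 'cV[R]_n) : R := Num.sqrt (\sum_(i < n) x i 0 ^+ 2).

Definition dotv n (a x : 'cV[R]_n) : R := (a^T *m x) 0 0.

Definition polyS n r (h : 'I_r -> 'cV[R]_n) (b : 'I_r -> R) (x : 'cV[R]_n) : Prop :=
  forall i, dotv (h i) x <= b i.

Definition U0A n s (V : 'I_s -> 'M[R]_n) (v : 'I_s -> R) (A : 'M[R]_n) : Prop :=
  forall j, \tr ((V j)^T *m A) <= v j.

Definition U0g n r (h : 'I_r -> 'cV[R]_n) (b : 'I_r -> R) (p : pexp) (gamma : R)
  (d : nat) (g : 'cV[R]_n -> 'cV[R]_n) : Prop :=
  forall x, polyS h b x -> norm_inf (g x) <= gamma * (norm_p p x) ^+ d.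

Definition UkA n s k (V : 'I_s -> 'M[R]_n) (v : 'I_s -> R) (p : pexp) (gamma : R)
  (d : nat) (xs ys : 'I_k -> 'cV[R]_n) (A : 'M[R]_n) : Prop :=
  U0A V v A /\ forall j, norm_inf (A *m xs j - ys j) <= gamma * (norm_p p (xs j)) ^+ d.

Definition robust_feasible n r s k (h : 'I_r -> 'cV[R]_n) (b : 'I_r -> R)
  (V : 'I_s -> 'M[R]_n) (v : 'I_s -> R) (p : pexp) (gamma : R) (d : nat)
  (xs ys : 'I_k -> 'cV[R]_n) (x : 'cV[R]_n) : Prop :=
  polyS h b x /\
  forall (A : 'M[R]_n) (g : 'cV[R]_n -> 'cV[R]_n),
    UkA V v p gamma d xs ys A -> U0g h b p gamma d g ->
    polyS h b (A *m x + g x).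

(* A second-order cone program in the variable z in R^N with m cone constraints
   ||F_i z + f_i||_2 <= c_i^T z + e_i  and objective  min q^T z. *)
Record socp (N : nat) := SOCP {
  socp_m : nat;
  socp_K : nat;
  socp_F : 'I_socp_m -> 'M[R]_(socp_K, N);
  socp_f : 'I_socp_m -> 'cV[R]_socp_K;
  socp_c : 'I_socp_m -> 'cV[R]_N;
  socp_e : 'I_socp_m -> R;
  socp_obj : 'cV[R]_N }.

Definition socp_feasible N (P : socp N) (z : 'cV[R]_N) : Prop :=
  forall i : 'I_(socp_m P),
    norm2 (@socp_F N P i *m z + @socp_f N P i) <= dotv (@socp_c N P i) z + @socp_e N P i.

Definition socp_reformulation n N (c : 'cV[R]_n) (Feas : 'cV[R]_n -> Prop)
  (P : socp (n + N)) : Prop :=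
  @socp_obj (n + N) P = col_mx c 0 /\
  forall x, Feas x <-> exists u : 'cV[R]_N, socp_feasible P (col_mx x u).

End Defs.

(* Main.v *)
Require Import Defs.
From HB Require Import structures.
From mathcomp Require Import all_boot all_order all_algebra.
From mathcomp Require Import all_classical all_reals.
From mathcomp Require Import exp.
From mathcomp Require Import ring lra.
Import Order.TTheory GRing.Theory Num.Theory.
Local Open Scope ring_scope.

Set Implicit Arguments.
Unset Strict Implicit.
Unset Printing Implicit Defensive.

(* Since g may be chosen freely at x inside the ball of radius
   gamma |x|_p^d, robust feasibility of x in S says that, for every i,
   h_i^T A x + gamma |x|_p^d |h_i|_1 <= b_i for all A in U_{k,A}.
   The set U_{k,A} is a polyhedron. If it is empty, the feasible set is S itself;
   otherwise linear programming duality replaces the quantifier over A by the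
   existence of multipliers subject to linear constraints in (x, multipliers).
   The only nonlinear ingredient left is t >= |x|_p^d. For p = a/b it splits into
   t >= s^d and |x_i|^a <= u_i^b s^(a-b) with sum u <= s, which are weighted
   geometric mean inequalities, obtained from a binary tree of rotated cones. *)

Lemma big_option (R : Type) (idx : R) (op : Monoid.com_law idx) (I : finType)
    (F : option I -> R) :
  \big[op/idx]_i F i = op (F None) (\big[op/idx]_i F (Some i)).
Proof.
rewrite (bigD1 None) //=; congr (op _ _).
rewrite (reindex_omap Some id) => [|[i|]] //.
by apply: eq_bigl => i; rewrite eqxx.
Qed.

(** * Farkas' lemma over an ordered field *)

Section Farkas.
Variables (R : realFieldType) (T J : finType).
Implicit Types (M : J -> T -> R) (w l : J -> R) (a c x : T -> R).

Definition pairing c x : R := \sum_t c t * x t.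

Lemma pairingBr c x y k :
  pairing c (fun t => x t - k * y t) = pairing c x - k * pairing c y.
Proof.
rewrite /pairing mulr_sumr -sumrB; apply: eq_bigr => t _; ring.
Qed.

Lemma pairingBl c d x k :
  pairing (fun t => c t - k * d t) x = pairing c x - k * pairing d x.
Proof.
rewrite /pairing mulr_sumr -sumrB; apply: eq_bigr => t _; ring.
Qed.

(* Bartl's induction: a separating point [x] for the constraints in [s] that
   violates the new constraint [j] is used to project everything along [x] onto
   the hyperplane where [j] vanishes, and the induction hypothesis is applied to
   the projected data. *)
Lemma farkas_seq (s : seq J) M c : uniq s ->
  (exists x, (forall j, j \in s -> pairing (M j) x <= 0) /\ 0 < pairing c x) \/
  (exists l, (forall j, 0 <= l j) /\
     forall t, c t = \sum_(j <- s) l j * M j t).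
Proof.
elim: s M c => [|j s IH] M c.
  move=> _; case: (pselect (forall t, c t = 0)) => [c0|/existsNP[t /eqP ct]].
    by right; exists (fun=> 0); split=> // t; rewrite big_nil.
  (* With no constraints, a nonzero [c] separates itself, as its pairing with itself is a sum of
     squares. *)
  left; exists c; split=> //.
  rewrite /pairing (bigD1 t) //= -expr2 ltr_wpDr ?exprn_even_gt0 //.
  by apply: sumr_ge0 => i _; rewrite -expr2 sqr_ge0.
move=> /= /andP[js us].
case: (IH M c us) => [[x [xs cx]]|[l [l0 cE]]]; last first.
  right; exists (fun i => if i == j then 0 else l i); split.
    by move=> i; case: ifP.
  move=> t; rewrite big_cons eqxx mul0r add0r cE !big_seq.
  by apply: eq_bigr => i ins; case: eqP => // E; rewrite -E ins in js.
case: (leP (pairing (M j) x) 0) => [Mx|Mx].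
  left; exists x; split=> // i; rewrite inE => /orP[/eqP->//|]; exact: xs.
set D := pairing (M j) x in Mx.
have D0 : D != 0 by rewrite gt_eqF.
(* These coefficients make [M i - k i * M j] and [c - kc * M j] vanish at [x]. *)
pose k i := pairing (M i) x / D.
pose kc := pairing c x / D.
case: (IH (fun i t => M i t - k i * M j t)
          (fun t => c t - kc * M j t) us) => [[y [ys cy]]|[l [l0 cE]]].
  (* The shift along [x] kills [M j]; on the shifted point [M i] and [c] take the values of their
     projected versions at [y]. *)
  left; exists (fun t => y t - pairing (M j) y / D * x t); split.
    move=> i; rewrite inE pairingBr => /orP[/eqP->|/ys].
      by rewrite -/D mulfVK // subrr.
    by rewrite pairingBl /k; apply: le_trans; rewrite le_eqVlt; apply/orP; left;
       apply/eqP; ring.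
  rewrite pairingBr; apply: lt_le_trans cy _; rewrite pairingBl /kc.
  by rewrite le_eqVlt; apply/orP; left; apply/eqP; ring.
(* The multiplier of [j] collects the [M j] terms when the projection is undone. It is nonnegative
   because [kc > 0] and [k i <= 0] for [i] in [s]. *)
right; exists (fun i => if i == j then kc - \sum_(i <- s) l i * k i else l i).
split.
  move=> i; case: ifP => // _; rewrite subr_ge0.
  apply: (@le_trans _ _ 0); last by rewrite divr_ge0 // ltW.
  rewrite big_seq; apply: sumr_le0 => i' /xs i's; apply: mulr_ge0_le0 => //.
  by rewrite /k ler_pdivrMr // mul0r.
move=> t; rewrite big_cons eqxx.
have -> : \sum_(i <- s) (if i == j then kc - \sum_(i <- s) l i * k i else l i)
    * M i t = \sum_(i <- s) l i * M i t.
  rewrite !big_seq; apply: eq_bigr => i ins.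
  by case: eqP => // E; rewrite -E ins in js.
have := cE t; under eq_bigr do rewrite mulrBr mulrA.
rewrite sumrB -mulr_suml => /(canRL (subrK _)) ->; ring.
Qed.

Lemma farkas M c :
  (forall x, (forall j, pairing (M j) x <= 0) -> pairing c x <= 0) ->
  exists l, (forall j, 0 <= l j) /\ forall t, c t = \sum_j l j * M j t.
Proof.
move=> H; case: (farkas_seq M c (index_enum_uniq J)) => // -[x [xs]].
rewrite ltNge H // => j; exact/xs/mem_index_enum.
Qed.

End Farkas.

(** * Linear programming duality in inhomogeneous form *)

Section LPDuality.
Variables (R : realFieldType) (T J : finType).
Implicit Types (M : J -> T -> R) (w l : J -> R) (a x : T -> R).

Lemma pairingDZ a x y (k : R) :
  pairing a (fun t => x t + k * y t) = pairing a x + k * pairing a y.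
Proof.
rewrite /pairing mulr_sumr -big_split; apply: eq_bigr => t _ /=; ring.
Qed.

Lemma pairingZ a y (k : R) :
  pairing a (fun t => k * y t) = k * pairing a y.
Proof. by rewrite /pairing mulr_sumr; apply: eq_bigr => t _; ring. Qed.

(** One direction is weak duality; the other is Farkas for the homogenized system. The feasible
    point [x0] excludes an inconsistent system, where the implication is vacuous but multipliers can
    fail to exist. *)
Lemma lp_duality M w a (beta : R) x0 :
  (forall j, pairing (M j) x0 <= w j) ->
  (forall x, (forall j, pairing (M j) x <= w j) -> pairing a x <= beta) <->
  exists l, [/\ forall j, 0 <= l j, forall t, a t = \sum_j l j * M j t
    & \sum_j l j * w j <= beta].
Proof.
move=> Mx0; split; last first.
  move=> [l [l0 aE lw]] x Mx; apply: le_trans lw; rewrite /pairing.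
  under eq_bigr do rewrite aE mulr_suml.
  rewrite exchange_big /=; apply: ler_sum => j _.
  under eq_bigr do rewrite -mulrA.
  by rewrite -mulr_sumr ler_wpM2l // Mx.
move=> H.
(* The coordinate [None] homogenizes the system, and the constraint [None]
   makes it nonnegative. *)
pose M' (j : option J) (t : option T) : R := match j, t with
  | Some j, Some t => M j t | Some j, None => - w j
  | None, Some _ => 0 | None, None => -1 end.
pose a' (t : option T) := if t is Some t then a t else - beta.
have pairO (c z : option T -> R) : pairing c z =
    c None * z None + pairing (c \o Some) (z \o Some).
  by rewrite /pairing big_option.
have [z Mz|l [l0 lE]] := @farkas R (option T) (option J) M' a'.
  have Mz' j : pairing (M j) (z \o Some) <= z None * w j.
    by have := Mz (Some j); rewrite pairO /= => ?; rewrite mulrC; lra.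
  have z0 : 0 <= z None.
    have := Mz None; rewrite pairO /= /pairing big1 => [|t _]; last exact: mul0r.
    by lra.
  rewrite pairO /= mulNr addrC subr_le0.
  have [z00|zn0] := eqVneq (z None) 0.
    rewrite z00 mulr0 leNgt; apply/negP => az.
    (* Here [z] is a recession direction, so [x0 + k z] stays feasible. This [k] lifts the objective
       to [pairing a x0 + 1 + |beta - pairing a x0|], which exceeds [beta]. *)
    pose k := (1 + `|beta - pairing a x0|) / pairing a (z \o Some).
    have k0 : 0 <= k by apply: divr_ge0 (ltW az); rewrite addr_ge0.
    have := H (fun t => x0 t + k * (z \o Some) t).
    rewrite pairingDZ /k divfK ?gt_eqF // -/k => H'.
    suff : pairing a x0 + (1 + `|beta - pairing a x0|) <= beta.
      by have := ler_norm (beta - pairing a x0); lra.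
    apply: H' => j; rewrite pairingDZ -[leRHS]addr0 lerD //.
    by rewrite mulr_ge0_le0 //; have := Mz' j; rewrite z00 mul0r.
  have zp : 0 < z None by rewrite lt_neqAle eq_sym zn0.
  have := H (fun t => (z None)^-1 * (z \o Some) t).
  rewrite pairingZ ler_pdivrMl // [z None * beta]mulrC; apply=> j.
  by rewrite pairingZ ler_pdivrMl.
exists (l \o Some); split=> [j|t|] /=; first exact: l0.
  by have := lE (Some t); rewrite big_option /= mulr0 add0r.
(* The homogenizing coordinate reads [beta = \sum_j l (Some j) * w j + l None], so [l None] is the
   slack of the dual bound. *)
have := lE None; rewrite big_option /= => E.
have : \sum_j l (Some j) * - w j = - \sum_j l (Some j) * w j.
  by rewrite -sumrN; apply: eq_bigr => j _; rewrite mulrN.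
by have := l0 None; lra.
Qed.

End LPDuality.

(** * Affine functions of finitely many real variables *)

Section Affine.
Variable R : realType.
Implicit Types I J : finType.

(** Variables are indexed by arbitrary finite types, so that joining or renaming them needs no
    ordinal arithmetic; cone data become matrices only in [soc_rep_socp]. *)
Definition affine I (f : (I -> R) -> R) : Prop :=
  exists (a : I -> R) (c : R), forall z, f z = \sum_i a i * z i + c.

Lemma affine_proj I (i : I) : affine (fun z => z i).
Proof.
exists (fun j => (j == i)%:R), 0 => z.
by rewrite (bigD1 i) //= eqxx mul1r big1 ?addr0 // => j /negbTE->; rewrite mul0r.
Qed.

Lemma affine_const I (c : R) : affine (fun _ : I -> R => c).
Proof.
by exists (fun=> 0), c => z; rewrite big1 ?add0r // => i _; rewrite mul0r.
Qed.

Lemma affineD I (f g : (I -> R) -> R) :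
  affine f -> affine g -> affine (fun z => f z + g z).
Proof.
move=> [a [c fE]] [a' [c' gE]]; exists (fun i => a i + a' i), (c + c') => z.
under eq_bigr do rewrite mulrDl.
by rewrite fE gE big_split /= addrACA.
Qed.

Lemma affineZ I (k : R) (f : (I -> R) -> R) :
  affine f -> affine (fun z => k * f z).
Proof.
move=> [a [c fE]]; exists (fun i => k * a i), (k * c) => z.
under eq_bigr do rewrite -mulrA.
by rewrite fE mulrDr mulr_sumr.
Qed.

Lemma affineZr I (k : R) (f : (I -> R) -> R) :
  affine f -> affine (fun z => f z * k).
Proof. by move/(affineZ k); under eq_fun do rewrite mulrC. Qed.

Lemma affineN I (f : (I -> R) -> R) : affine f -> affine (fun z => - f z).
Proof. by move/(affineZ (-1)); under eq_fun do rewrite mulN1r. Qed.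

Lemma affineB I (f g : (I -> R) -> R) :
  affine f -> affine g -> affine (fun z => f z - g z).
Proof. by move=> af /affineN; apply: affineD. Qed.

Lemma affine_sum I (K : Type) (s : seq K) (f : K -> (I -> R) -> R) :
  (forall k, affine (f k)) -> affine (fun z => \sum_(k <- s) f k z).
Proof.
move=> af; elim: s => [|k s IH].
  under eq_fun do rewrite big_nil; exact: affine_const.
by under eq_fun do rewrite big_cons; apply: affineD.
Qed.

(** With coordinate maps for [phi], this carries constraints over to an enlarged family of
    variables. *)
Lemma affine_comp I J (f : (I -> R) -> R) (phi : (J -> R) -> I -> R) :
  affine f -> (forall i, affine (fun z => phi z i)) ->
  affine (fun z => f (phi z)).
Proof.
move=> [a [c fE]] aphi; under eq_fun do rewrite fE.
by apply: affineD (affine_const _ _); apply: affine_sum => i; apply: affineZ.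
Qed.

End Affine.

(** * Calculus of second-order cone representable sets *)

Section Representability.
Variable R : realType.
Implicit Types I J K : finType.

Definition join I J (x : I -> R) (u : J -> R) (s : I + J) : R :=
  match s with inl i => x i | inr j => u j end.

(* [Q] is the projection of a set cut out by second-order cone constraints, one
   for each element of [M]; [J] indexes the auxiliary variables. *)
Definition soc_rep I (Q : (I -> R) -> Prop) : Prop :=
  exists (J M K : finType) (a : M -> K -> (I + J -> R) -> R)
         (g : M -> (I + J -> R) -> R),
    [/\ forall i k, affine (a i k), forall i, affine (g i)
      & forall x, Q x <-> exists u, forall i,
          Num.sqrt (\sum_k a i k (join x u) ^+ 2) <= g i (join x u)].

Lemma soc_rep_iff I (Q Q' : (I -> R) -> Prop) :
  (forall x, Q x <-> Q' x) -> soc_rep Q -> soc_rep Q'.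
Proof.
move=> QQ' [J [M [K [a [g [aa ag H]]]]]]; exists J, M, K, a, g; split=> // x.
by rewrite -QQ'.
Qed.

Lemma soc_rep_cone I K (a : K -> (I -> R) -> R) (g : (I -> R) -> R) :
  (forall k, affine (a k)) -> affine g ->
  soc_rep (fun x => Num.sqrt (\sum_k a k x ^+ 2) <= g x).
Proof.
move=> aa ag; exists void, unit, K, (fun _ k z => a k (z \o inl)),
  (fun _ z => g (z \o inl)); split.
- by move=> _ k; apply: affine_comp (aa k) _ => i; apply: affine_proj.
- by move=> _; apply: affine_comp ag _ => i; apply: affine_proj.
- by move=> x; split=> [Hx|[u /(_ tt)]//]; exists (fun v : void => match v with end).
Qed.

(** The auxiliary variables are kept disjoint. All cones share one row type, so each cone gets zero
    rows in the other summand, which leave its norm unchanged. *)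
Lemma soc_rep_and I (Q1 Q2 : (I -> R) -> Prop) :
  soc_rep Q1 -> soc_rep Q2 -> soc_rep (fun x => Q1 x /\ Q2 x).
Proof.
move=> [J1 [M1 [K1 [a1 [g1 [aa1 ag1 H1]]]]]] [J2 [M2 [K2 [a2 [g2 [aa2 ag2 H2]]]]]].
pose rho1 (z : I + (J1 + J2) -> R) : I + J1 -> R :=
  join (z \o inl) (z \o inr \o inl).
pose rho2 (z : I + (J1 + J2) -> R) : I + J2 -> R :=
  join (z \o inl) (z \o inr \o inr).
have arho1 s : affine (fun z => rho1 z s) by case: s => ?; apply: affine_proj.
have arho2 s : affine (fun z => rho2 z s) by case: s => ?; apply: affine_proj.
exists (J1 + J2)%type, (M1 + M2)%type, (K1 + K2)%type,
  (fun i k z => match i, k with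
     | inl i, inl k => a1 i k (rho1 z) | inr i, inr k => a2 i k (rho2 z)
     | _, _ => 0 end),
  (fun i z => match i with
     | inl i => g1 i (rho1 z) | inr i => g2 i (rho2 z) end).
split.
- by move=> [i|i] [k|k]; try exact: affine_const; apply: affine_comp.
- by move=> [i|i]; apply: affine_comp.
move=> x; rewrite H1 H2; split=> [[[u1 h1] [u2 h2]]|[u h]].
  exists (join u1 u2) => -[i|i]; rewrite big_sumType /=.
    by rewrite [X in _ + X]big1 ?addr0 //= => k _; rewrite expr0n.
  by rewrite [X in X + _]big1 ?add0r //= => k _; rewrite expr0n.
split.
  exists (u \o inl) => i; have := h (inl i); rewrite big_sumType /=.
  by rewrite [X in _ + X]big1 ?addr0 //= => k _; rewrite expr0n.
exists (u \o inr) => i; have := h (inr i); rewrite big_sumType /=.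
by rewrite [X in X + _]big1 ?add0r //= => k _; rewrite expr0n.
Qed.

(** A projection of a projection is a projection: the quantified [u] joins the auxiliary variables,
    and [rho] only reassociates the index types. *)
Lemma soc_rep_exists I K (Q : (I -> R) -> (K -> R) -> Prop) :
  soc_rep (fun z : I + K -> R => Q (z \o inl) (z \o inr)) ->
  soc_rep (fun x => exists u, Q x u).
Proof.
move=> [J [M [K' [a [g [aa ag H]]]]]].
pose rho (z : I + (K + J) -> R) : (I + K) + J -> R :=
  join (join (z \o inl) (z \o inr \o inl)) (z \o inr \o inr).
have arho s : affine (fun z => rho z s).
  by case: s => [[]|] ?; apply: affine_proj.
exists (K + J)%type, M, K', (fun i k z => a i k (rho z)),
  (fun i z => g i (rho z)).
split; [by move=> *; apply: affine_comp|by move=> *; apply: affine_comp|].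
move=> x; split=> [[u Qxu]|[w hw]].
  have /H[v hv] : Q (join x u \o inl) (join x u \o inr) by [].
  by exists (join u v).
by exists (w \o inl); apply/(H (join x (w \o inl))); exists (w \o inr).
Qed.

(** A linear inequality is a cone constraint whose norm has no rows, hence the index type [void]. *)
Lemma soc_rep_le I (f g : (I -> R) -> R) :
  affine f -> affine g -> soc_rep (fun x => f x <= g x).
Proof.
move=> af ag.
apply: soc_rep_iff (@soc_rep_cone I void (fun=> fun=> 0) (fun x => g x - f x) _ _).
- by move=> x; rewrite big1 ?sqrtr0 ?subr_ge0 // => -[].
- by case.
- exact: affineB.
Qed.

Lemma soc_rep_eq I (f g : (I -> R) -> R) :
  affine f -> affine g -> soc_rep (fun x => f x = g x).
Proof.
move=> af ag.
apply: soc_rep_iff (soc_rep_and (soc_rep_le af ag) (soc_rep_le ag af)) => x.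
by split=> [[? ?]|->//]; apply/eqP; rewrite eq_le; apply/andP.
Qed.

Lemma soc_rep_forall I K (Q : K -> (I -> R) -> Prop) :
  (forall k, soc_rep (Q k)) -> soc_rep (fun x => forall k, Q k x).
Proof.
move=> rQ.
suff rs (s : seq K) : soc_rep (fun x => forall k, k \in s -> Q k x).
  apply: soc_rep_iff (rs (enum K)) => x; split=> h k => [|_]; apply: h.
  by rewrite mem_enum.
elim: s => [|j s IH].
  apply: soc_rep_iff (soc_rep_le (affine_const _ 0) (affine_const _ 0)) => x.
  by split.
apply: soc_rep_iff (soc_rep_and (rQ j) IH) => x; split.
  by move=> [Qj Qs] k; rewrite inE => /orP[/eqP->|/Qs].
move=> h; split=> [|k ks]; apply: h; rewrite inE ?eqxx // ks orbT //.
Qed.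

(* [f^2 <= g * h] is the cone constraint [|(2 f, g - h)| <= g + h]. *)
Lemma soc_rep_rotated I (f g h : (I -> R) -> R) :
  affine f -> affine g -> affine h ->
  soc_rep (fun x => [/\ 0 <= g x, 0 <= h x & f x ^+ 2 <= g x * h x]).
Proof.
move=> af ag ah.
pose a (c : bool) x := if c then 2 * f x else g x - h x.
have aa c : affine (a c) by case: c; [apply: affineZ|apply: affineB].
apply: soc_rep_iff (soc_rep_cone aa (affineD ag ah)) => x.
have -> : \sum_c a c x ^+ 2 = 4 * f x ^+ 2 + (g x - h x) ^+ 2.
  by rewrite (bigD1 true) //= (bigD1 false) //= big1 ?addr0 => [|[]//]; ring.
have s0 : 0 <= 4 * f x ^+ 2 + (g x - h x) ^+ 2.
  by have := sqr_ge0 (f x); have := sqr_ge0 (g x - h x); lra.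
split=> [le_s|[g0 h0 fgh]]; last first.
  rewrite -(@ler_pXn2r _ 2) ?nnegrE ?sqrtr_ge0 ?addr_ge0 // sqr_sqrtr //.
  by nra.
have gh0 : 0 <= g x + h x by apply: le_trans le_s; rewrite sqrtr_ge0.
move: le_s; rewrite -(@ler_pXn2r _ 2) ?nnegrE ?sqrtr_ge0 // sqr_sqrtr // => le_s.
have f2 := sqr_ge0 (f x).
have fgh : f x ^+ 2 <= g x * h x by nra.
(* Both [g + h] and [g * h] are nonnegative, which rules out a negative factor. *)
by split=> //; rewrite leNgt; apply/negP => neg; nra.
Qed.

End Representability.

(** * Geometric means and powers by rotated cones *)

Section PowerCones.
Variable R : realType.
Implicit Types I J K : finType.

Lemma nonneg_root_exists (x : R) m : 0 <= x -> (0 < m)%N ->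
  exists2 y, 0 <= y & y ^+ m = x.
Proof.
move=> x0 m0; exists (powR x m%:R^-1); first exact: powR_ge0.
by rewrite -powR_mulrn ?powR_ge0 // -powRrM mulVf ?powRr1 // pnatr_eq0 -lt0n.
Qed.

(* Binary tree of rotated cones: [g^2 <= y z], with [y] and [z] dominated by the
   geometric means of the two halves of the family. *)
Lemma soc_rep_geomean_pow2 l I (g : (I -> R) -> R) (f : nat -> (I -> R) -> R) :
  affine g -> (forall i, affine (f i)) ->
  soc_rep (fun x => [/\ 0 <= g x, forall i, (i < 2 ^ l)%N -> 0 <= f i x
    & g x ^+ (2 ^ l) <= \prod_(i < 2 ^ l) f i x]).
Proof.
elim: l I g f => [|l IH] I g f ag af.
  apply: soc_rep_iff (soc_rep_and (soc_rep_le (affine_const _ 0) ag)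
    (soc_rep_le ag (af 0))) => x.
  rewrite expn0 expr1 big_ord1; split=> [[g0 gf]|[]//]; split=> // -[|//] _.
  exact: le_trans gf.
set m := (2 ^ l)%N in IH *.
have m0 : (0 < m)%N by rewrite expn_gt0.
have -> : (2 ^ l.+1 = m + m)%N by rewrite expnS mul2n addnn.
pose geo (f : nat -> (I -> R) -> R) x (y : R) :=
  [/\ 0 <= y, forall i, (i < m)%N -> 0 <= f i x & y ^+ m <= \prod_(i < m) f i x].
pose Q x (u : bool -> R) := [/\ 0 <= u true, 0 <= u false &
  g x ^+ 2 <= u true * u false] /\
  (0 <= g x /\ (geo f x (u true) /\ geo (fun i => f (m + i)%N) x (u false))).
have rQ : soc_rep (fun x => exists u, Q x u).
  apply: soc_rep_exists.
  have agl : affine (fun z : I + bool -> R => g (z \o inl)).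
    by apply: affine_comp ag _ => i; apply: affine_proj.
  have afl i : affine (fun z : I + bool -> R => f i (z \o inl)).
    by apply: affine_comp (af i) _ => ?; apply: affine_proj.
  apply: soc_rep_and.
    by apply: soc_rep_rotated => //; apply: affine_proj.
  apply: soc_rep_and; first by apply: soc_rep_le => //; apply: affine_const.
  by apply: soc_rep_and; apply: IH => //; apply: affine_proj.
apply: soc_rep_iff rQ => x; split.
  move=> [u [[u0 v0 guv] [g0 [[_ f0 uf] [_ f0' vf]]]]]; split=> //.
    move=> i; case: (ltnP i m) => [/f0//|mi im]; rewrite -(subnKC mi); apply: f0'.
    by rewrite ltn_subLR.
  rewrite big_split_ord /= addnn -mul2n exprM.
  apply: (@le_trans _ _ ((u true * u false) ^+ m)).
    by apply: lerXn2r; rewrite ?nnegrE ?sqr_ge0 ?mulr_ge0.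
  by rewrite exprMn; apply: ler_pM; rewrite ?exprn_ge0.
move=> [g0 f0 gf].
have pr0 (F : nat -> R) : (forall i, (i < m)%N -> 0 <= F i) ->
    0 <= \prod_(i < m) F i by move=> F0; apply: prodr_ge0 => i _; apply: F0.
have f1 i : (i < m)%N -> 0 <= f i x by move=> im; apply: f0; rewrite ltn_addr.
have f2 i : (i < m)%N -> 0 <= f (m + i)%N x by move=> im; apply: f0; rewrite ltn_add2l.
(* The values at the tree node are the exact geometric means of the two halves. *)
have [y y0 yE] := nonneg_root_exists (pr0 (fun i => f i x) f1) m0.
have [z z0 zE] := nonneg_root_exists (pr0 (fun i => f (m + i)%N x) f2) m0.
exists (fun c => if c then y else z); split; split=> //.
  rewrite -(@ler_pXn2r _ m) ?nnegrE ?sqr_ge0 ?mulr_ge0 //=.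
  rewrite [leRHS]exprMn yE zE -exprM mul2n.
  by move: gf; rewrite big_split_ord /= addnn.
by split; split; rewrite ?yE ?zE.
Qed.

(* The family is padded to length [2 ^ l] with copies of [g] itself, which
   cancel on both sides of the inequality. *)
Lemma soc_rep_weighted_geomean I (g f h : (I -> R) -> R) (k m : nat) :
  affine g -> affine f -> affine h -> (0 < k + m)%N ->
  soc_rep (fun x => [/\ 0 <= g x, 0 <= f x, 0 <= h x
    & g x ^+ (k + m) <= f x ^+ k * h x ^+ m]).
Proof.
move=> ag af ah km0.
have ltkm : (k + m < 2 ^ (k + m))%N by apply: ltn_expl.
pose e := (2 ^ (k + m) - (k + m))%N.
have eE : (2 ^ (k + m) = k + (m + e))%N by rewrite addnA subnKC // ltnW.
pose F i := if (i < k)%N then f else if (i < k + m)%N then h else g.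
have aF i : affine (F i) by rewrite /F; case: ifP => // _; case: ifP.
have a0 := @affine_const R I 0.
apply: soc_rep_iff (soc_rep_and (soc_rep_le a0 af) (soc_rep_and
  (soc_rep_le a0 ah) (soc_rep_geomean_pow2 (k + m) ag aF))) => x.
have prE : \prod_(i < 2 ^ (k + m)) F i x = f x ^+ k * h x ^+ m * g x ^+ e.
  rewrite eE big_split_ord big_split_ord /= mulrA.
  congr (_ * _ * _).
  - by under eq_bigr do rewrite /F ltn_ord; rewrite prodr_const card_ord.
  - under eq_bigr do rewrite /F ltnNge leq_addr /= ltn_add2l ltn_ord.
    by rewrite prodr_const card_ord.
  - under eq_bigr do rewrite /F ltnNge leq_addr /= ltn_add2l ltnNge leq_addr /=.
    by rewrite prodr_const card_ord.
have gE : g x ^+ (2 ^ (k + m)) = g x ^+ (k + m) * g x ^+ e.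
  by rewrite -exprD eE addnA.
rewrite prE gE; split.
  move=> [f0 [h0 [g0 _ le]]]; split=> //.
  (* The padding factor [g x ^+ e] cannot be cancelled when [g x = 0], but then the left side is
     zero since [0 < k + m]. *)
  have [->|gn0] := eqVneq (g x) 0.
    by rewrite expr0n gtn_eqF // mulr_ge0 ?exprn_ge0.
  by move: le; rewrite ler_pM2r // exprn_gt0 // lt_neqAle eq_sym gn0.
move=> [g0 f0 h0 le]; split=> //; split=> //; split=> //.
  by move=> i _; rewrite /F; case: ifP => // _; case: ifP.
by rewrite ler_wpM2r // exprn_ge0.
Qed.

(** For a positive exponent this is a geometric mean inequality padded with the constant [1]. For
    exponent [0] the power is [1] even at [f x = 0], so the condition is linear. *)
Lemma soc_rep_power I (f g : (I -> R) -> R) d : affine f -> affine g ->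
  soc_rep (fun x => [/\ 0 <= f x, 0 <= g x & f x ^+ d <= g x]).
Proof.
move=> af ag; have a1 := @affine_const R I 1; have a0 := @affine_const R I 0.
case: d => [|d].
  apply: soc_rep_iff (soc_rep_and (soc_rep_le a0 af) (soc_rep_le a1 ag)) => x.
  rewrite expr0; split=> [[? h]|[? ? ?]//]; split=> //; exact: le_trans h.
apply: soc_rep_iff (@soc_rep_weighted_geomean I f g (fun=> 1) 1 d af ag a1 _) => // x.
rewrite expr1 expr1n mulr1 add1n; split=> [[]//|[]]; by split.
Qed.

(** * The [p]-norm for a rational exponent [e = a / b] *)

Section RationalNorm.
Variables (a b n : nat).
Hypothesis b0 : (0 < b)%N.
Hypothesis ba : (b <= a)%N.
Let e : R := a%:R / b%:R.

Lemma powR_ratioX (x : R) : 0 <= x -> powR x e ^+ b = x ^+ a.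
Proof.
move=> x0; rewrite -powR_mulrn ?powR_ge0 // -powRrM /e mulfVK ?powR_mulrn //.
by rewrite pnatr_eq0 -lt0n.
Qed.

(** The [b]-th power of the conclusion is the hypothesis, since [e * b = a] and
    [(e - 1) * b = a - b]. *)
Lemma power_mean_le (x u t : R) : 0 <= u -> 0 < t ->
  `|x| ^+ a <= u ^+ b * t ^+ (a - b) -> powR `|x| e <= u * powR t (e - 1).
Proof.
move=> u0 t0 le.
rewrite -(@ler_pXn2r _ b) ?nnegrE ?mulr_ge0 ?powR_ge0 // powR_ratioX //.
apply: le_trans le _; rewrite exprMn ler_wpM2l ?exprn_ge0 //.
rewrite -[leRHS]powR_mulrn ?powR_ge0 // -powRrM mulrBl mul1r /e mulfVK; last first.
  by rewrite pnatr_eq0 -lt0n.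
by rewrite -natrB // powR_mulrn // ltW.
Qed.

(* A perspective reformulation: [|z i|^e <= u i * t^(e-1)] and [sum u <= t]. *)
Lemma normp_leP (z : 'I_n -> R) (t : R) :
  powR (\sum_i powR `|z i| e) e^-1 <= t <->
  0 <= t /\ exists u : 'I_n -> R,
    [/\ forall i, 0 <= u i, \sum_i u i <= t
      & forall i, `|z i| ^+ a <= u i ^+ b * t ^+ (a - b)].
Proof.
have b0' : b%:R != 0 :> R by rewrite pnatr_eq0 -lt0n.
have a0 : (0 < a)%N by apply: leq_trans ba.
have e0 : 0 < e by rewrite divr_gt0 ?ltr0n.
have en0 : e != 0 by rewrite gt_eqF.
have S0 : 0 <= \sum_i powR `|z i| e by apply: sumr_ge0 => i _; apply: powR_ge0.
split=> [le_t|[t0 [u [u0 ut uz]]]].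
  have t0 : 0 <= t by apply: le_trans le_t; apply: powR_ge0.
  have St : \sum_i powR `|z i| e <= powR t e.
    rewrite -[leLHS]powRr1 // -(mulVf en0) powRrM.
    by apply: ge0_ler_powR; rewrite ?nnegrE ?powR_ge0 // ltW.
  (* The witness for positive [t] relies on cancelling powers of [t]. At [t = 0] all [z i] vanish
     and [u = 0] works. *)
  split=> //; have [tz|tn0] := eqVneq t 0.
    exists (fun=> 0); split=> // [|i]; first by rewrite big1.
    rewrite tz powR0 // in St.
    have S00 : \sum_i powR `|z i| e = 0 by apply: le_anti; rewrite St S0.
    have /eqP : powR `|z i| e = 0.
      by apply: (psumr_eq0P _ S00) => // j _; apply: powR_ge0.
    rewrite powR_eq0 en0 andbT => /eqP ->.
    by rewrite expr0n gtn_eqF // mulr_ge0 // exprn_ge0 // tz.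
  have tp : 0 < t by rewrite lt_neqAle eq_sym tn0.
  (* This is the [u i] for which the perspective constraint is an equality; the sum is at most
     [t^e * t^(1-e) = t]. *)
  exists (fun i => powR `|z i| e * powR t (1 - e)); split.
  - by move=> i; rewrite mulr_ge0 ?powR_ge0.
  - rewrite -mulr_suml; apply: le_trans (_ : powR t e * powR t (1 - e) <= _).
      by rewrite ler_wpM2r ?powR_ge0.
    by rewrite -powRD ?tn0 ?implybT // addrC subrK powRr1.
  move=> i; have tE : powR t (1 - e) ^+ b * t ^+ (a - b) = 1.
    rewrite -[_ ^+ b]powR_mulrn ?powR_ge0 // -powRrM -[_ ^+ (a - b)]powR_mulrn //.
    rewrite -powRD ?tn0 ?implybT // mulrBl mul1r /e mulfVK // natrB //.
    by rewrite addrC subrKA subrr powRr0.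
  by rewrite exprMn powR_ratioX // -mulrA tE mulr1.
(* At [t = 0] the bound on the sum forces [u = 0], and [0 < b] then gives [z = 0]. *)
have [tz|tn0] := eqVneq t 0.
  have z0 i : z i = 0.
    have us0 : \sum_i u i = 0.
      by apply: le_anti; rewrite sumr_ge0 // andbT; rewrite tz in ut.
    have ui0 : u i = 0 by apply: (psumr_eq0P _ us0) => // j _; apply: u0.
    have := uz i; rewrite ui0 expr0n gtn_eqF //.
    rewrite mul0r => le0; apply/eqP; rewrite -normr_le0 leNgt.
    by apply/negP => /(exprn_gt0 a); rewrite ltNge le0.
  rewrite big1 ?powR0 ?invr_eq0 // => i _.
  by rewrite z0 normr0 powR0.
have tp : 0 < t by rewrite lt_neqAle eq_sym tn0.
rewrite -[leRHS]powRr1 // -(mulfV en0) powRrM.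
apply: ge0_ler_powR; rewrite ?nnegrE ?powR_ge0 ?invr_ge0 ?(ltW e0) //.
(* Summing the perspective bounds gives at most [t * t^(e-1) = t^e]. *)
apply: le_trans (_ : \sum_i u i * powR t (e - 1) <= _).
  by apply: ler_sum => i _; apply: power_mean_le.
rewrite -mulr_suml -[leRHS]mulr_powRB1 //.
by rewrite ler_wpM2r ?powR_ge0.
Qed.

End RationalNorm.

End PowerCones.

(** * Norm constraints, passage to matrix form, and the worst-case perturbation *)

Section Reformulation.
Variable R : realType.
Implicit Types I J K : finType.

Lemma norm_inf_leP n (x : 'cV[R]_n) (t : R) :
  norm_inf x <= t <-> 0 <= t /\ forall i, `|x i 0| <= t.
Proof.
split=> [/bigmax_leP[t0 H]|[t0 H]]; first by split=> // i; apply: H.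
by apply/bigmax_leP; split=> // i _; apply: H.
Qed.

Lemma norm_inf_ge0 n (x : 'cV[R]_n) : 0 <= norm_inf x.
Proof. by have /norm_inf_leP[] := lexx (norm_inf x). Qed.

Lemma le_norm_inf n (x : 'cV[R]_n) i : `|x i 0| <= norm_inf x.
Proof. by have /norm_inf_leP[_] := lexx (norm_inf x). Qed.

Lemma norm_p_ge0 n p (x : 'cV[R]_n) : 0 <= norm_p p x.
Proof. case: p => [|q]; [exact: norm_inf_ge0|exact: powR_ge0]. Qed.

Lemma soc_rep_norm_le I (f t : (I -> R) -> R) : affine f -> affine t ->
  soc_rep (fun x => `|f x| <= t x).
Proof.
move=> af at'.
apply: soc_rep_iff (soc_rep_and (soc_rep_le (affineN at') af)
  (soc_rep_le af at')) => x.
by rewrite ler_norml; split=> [[-> ->]|/andP].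
Qed.

(** The fraction in lowest terms serves; [b <= a] makes the natural subtraction [a - b] exact
    later. *)
Lemma ratr_ge1_frac (q : rat) : 1 <= q -> exists a b : nat,
  [/\ (0 < b)%N, (b <= a)%N & ratr q = a%:R / b%:R :> R].
Proof.
move=> q1; exists `|numq q|%N, `|denq q|%N; split.
- by rewrite absz_gt0 denq_neq0.
- have q0 : 0 <= q by apply: le_trans q1.
  rewrite -lez_nat !gez0_abs ?numq_ge0 ?denq_ge0 //.
  move: q1; rewrite -[q in _ <= q]divq_num_den ler_pdivlMr ?ltr0z ?denq_gt0 //.
  by rewrite mul1r ler_int.
- have q0 : 0 <= q by apply: le_trans q1.
  by rewrite !natr_absz !ger0_norm ?numq_ge0 ?denq_ge0.
Qed.

Lemma soc_rep_norm_p n p I (f : 'I_n -> (I -> R) -> R) (t : (I -> R) -> R) :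
  pexp_ok p -> (forall i, affine (f i)) -> affine t ->
  soc_rep (fun x => norm_p p (\col_i f i x) <= t x).
Proof.
move=> + af at'; have a0 := @affine_const R I 0; case: p => [_|q q1].
  apply: soc_rep_iff (soc_rep_and (soc_rep_le a0 at')
    (soc_rep_forall (fun i => soc_rep_norm_le (af i) at'))) => x.
  rewrite norm_inf_leP; split=> -[t0 H]; split=> // i; have := H i; by rewrite mxE.
have [a [b [b0 ba qE]]] := ratr_ge1_frac q1.
(* [w (inl i)] is the perspective variable of [normp_leP], and [w (inr i)] is a linear stand-in
   above the non-affine [|f i x|]. The exponent [b + (a - b)] is [a] in the shape of the geometric
   mean lemma. *)
pose Q x (w : 'I_n + 'I_n -> R) :=
  (\sum_i w (inl i) <= t x /\ forall i, `|f i x| <= w (inr i)) /\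
  (0 <= t x /\ forall i, [/\ 0 <= w (inr i), 0 <= w (inl i), 0 <= t x
    & w (inr i) ^+ (b + (a - b)) <= w (inl i) ^+ b * t x ^+ (a - b)]).
have rQ : soc_rep (fun x => exists w, Q x w).
  apply: soc_rep_exists.
  have afl i : affine (fun z : I + ('I_n + 'I_n) -> R => f i (z \o inl)).
    by apply: affine_comp (af i) _ => ?; apply: affine_proj.
  have atl : affine (fun z : I + ('I_n + 'I_n) -> R => t (z \o inl)).
    by apply: affine_comp at' _ => ?; apply: affine_proj.
  have ap s : affine (fun z : I + ('I_n + 'I_n) -> R => (z \o inr) s).
    exact: affine_proj.
  apply: soc_rep_and; apply: soc_rep_and.
  - by apply: soc_rep_le => //; apply: affine_sum.
  - by apply: soc_rep_forall => i; apply: soc_rep_norm_le.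
  - by apply: soc_rep_le => //; apply: affine_const.
  - by apply: soc_rep_forall => i; apply: soc_rep_weighted_geomean => //;
      rewrite subnKC // (leq_trans b0).
apply: soc_rep_iff rQ => x.
have -> : norm_p (PRat q) (\col_i f i x) =
    powR (\sum_i powR `|f i x| (a%:R / b%:R)) (a%:R / b%:R)^-1.
  by rewrite /= qE; under eq_bigr do rewrite mxE.
apply: iff_trans (iff_sym (normp_leP b0 ba (fun i => f i x) (t x))).
rewrite /Q subnKC //; split.
  move=> [w [[wt fw] [t0 H]]]; split=> //; exists (w \o inl); split=> // i.
    by have [] := H i.
  have [y0 _ _] := H i; apply: le_trans.
  by apply: lerXn2r; rewrite ?nnegrE.
move=> [t0 [u [u0 ut H]]].
by exists (join u (fun i => `|f i x|)); split; split=> //= i; split.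
Qed.

Lemma dotvE n (a x : 'cV[R]_n) : dotv a x = \sum_i a i 0 * x i 0.
Proof. by rewrite /dotv mxE; apply: eq_bigr => i _; rewrite mxE. Qed.

(** The finite index types are enumerated by ordinals. The coordinates of [x] come first and the
    auxiliary ones last, so the objective is [c] padded with zeros. *)
Lemma soc_rep_socp n (c : 'cV[R]_n) (Q : ('I_n -> R) -> Prop) :
  soc_rep Q -> exists (N : nat) (P : socp R (n + N)),
    socp_reformulation c (fun x => Q (fun i => x i 0)) P.
Proof.
move=> [J [M [K [a [g [aa ag H]]]]]].
have split_affine I (f : (I -> R) -> R) : affine f ->
    exists Ac : (I -> R) * R, forall z, f z = \sum_i Ac.1 i * z i + Ac.2.
  by move=> [A [k fE]]; exists (A, k).
(* Choice turns the existential affine forms into coefficient arrays for the cone data. *)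
have [A aE] := boolp.choice (fun ik : M * K => split_affine _ _ (aa ik.1 ik.2)).
have [G gE] := boolp.choice (fun i => split_affine _ _ (ag i)).
pose var (l : 'I_(n + #|J|)) : 'I_n + J :=
  match fintype.split l with inl i => inl i | inr j => inr (enum_val j) end.
pose point (x : 'cV[R]_n) (u : 'cV[R]_#|J|) : 'I_n + J -> R :=
  join (fun i => x i 0) (fun j => u (enum_rank j) 0).
have sumE (B : 'I_n + J -> R) x u : \sum_l B (var l) * col_mx x u l 0 =
    \sum_s B s * point x u s.
  rewrite big_split_ord big_sumType /=; congr (_ + _).
    by apply: eq_bigr => i _; rewrite /var (unsplitK (inl i)) col_mxEu.
  rewrite [RHS](reindex_onto enum_val enum_rank) => [|j _]; last exact: enum_rankK.
  apply: eq_big => [j|j _]; first by rewrite enum_valK eqxx.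
  by rewrite /var (unsplitK (inr j)) col_mxEd enum_valK.
pose P := @SOCP R (n + #|J|) #|M| #|K|
  (fun i => \matrix_(k, l) (A (enum_val i, enum_val k)).1 (var l))
  (fun i => \col_k (A (enum_val i, enum_val k)).2)
  (fun i => \col_l (G (enum_val i)).1 (var l))
  (fun i => (G (enum_val i)).2) (col_mx c 0).
have coneE x u (i : 'I_#|M|) :
    (norm2 (@socp_F _ _ P i *m col_mx x u + @socp_f _ _ P i) <=
      dotv (@socp_c _ _ P i) (col_mx x u) + @socp_e _ _ P i) =
    (Num.sqrt (\sum_k a (enum_val i) k (point x u) ^+ 2) <=
      g (enum_val i) (point x u)).
  rewrite gE /norm2 dotvE /=; congr (Num.sqrt _ <= _ + _); last first.
    by rewrite -sumE; apply: eq_bigr => l _; rewrite mxE.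
  rewrite [RHS](reindex_onto enum_val enum_rank) => [|k _]; last exact: enum_rankK.
  apply: eq_big => [k|k _]; first by rewrite enum_valK eqxx.
  rewrite !mxE (aE (enum_val i, enum_val k)) -sumE.
  by congr ((_ + _) ^+ 2); apply: eq_bigr => l _; rewrite mxE.
exists #|J|, P; split=> // x; rewrite H; split=> [[u Hu]|[u Hu]].
  exists (\col_j u (enum_val j)) => i; rewrite coneE.
  have -> : point x (\col_j u (enum_val j)) = join (fun i => x i 0) u.
    by apply/funext => -[//|j] /=; rewrite mxE enum_rankK.
  exact: Hu.
exists (fun j => u (enum_rank j) 0) => i.
by have := Hu (enum_rank i); rewrite coneE enum_rankK.
Qed.

Lemma dotvD n (a x y : 'cV[R]_n) : dotv a (x + y) = dotv a x + dotv a y.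
Proof. by rewrite /dotv mulmxDr mxE. Qed.

Lemma ler_dotv_norm_inf n (a x : 'cV[R]_n) :
  dotv a x <= norm_inf x * \sum_i `|a i 0|.
Proof.
rewrite dotvE mulr_sumr; apply: ler_sum => i _.
apply: le_trans (ler_norm _) _; rewrite normrM mulrC.
by rewrite ler_wpM2r ?le_norm_inf.
Qed.

(* The worst perturbation at [x] is [gamma * norm_p p x ^+ d] times the sign
   vector of [h i], extended by zero away from [x]. *)
Lemma robust_feasibleP n r s k (h : 'I_r -> 'cV[R]_n) (b : 'I_r -> R)
    (V : 'I_s -> 'M[R]_n) (v : 'I_s -> R) (p : pexp) (gamma : R) (d : nat)
    (xs ys : 'I_k -> 'cV[R]_n) (x : 'cV[R]_n) : 0 <= gamma ->
  robust_feasible h b V v p gamma d xs ys x <->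
  polyS h b x /\ forall i A, UkA V v p gamma d xs ys A ->
    dotv (h i) (A *m x) <=
      b i - gamma * norm_p p x ^+ d * \sum_l `|h i l 0|.
Proof.
move=> gamma0; have rad0 y : 0 <= gamma * norm_p p y ^+ d.
  by rewrite mulr_ge0 // exprn_ge0 // norm_p_ge0.
split=> -[Sx H]; split=> //; last first.
  move=> A g UA Ug i; rewrite dotvD; have := H i A UA.
  have : dotv (h i) (g x) <= gamma * norm_p p x ^+ d * \sum_l `|h i l 0|.
    apply: le_trans (ler_dotv_norm_inf _ _) _; rewrite ler_wpM2r ?Ug //.
    exact: sumr_ge0.
  by lra.
move=> i A UA.
pose g y : 'cV[R]_n := if y == x
  then \col_l (gamma * norm_p p x ^+ d * Num.sg (h i l 0)) else 0.
have Ug : U0g h b p gamma d g.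
  move=> y _; apply/norm_inf_leP; split=> // l; rewrite /g.
  case: eqP => [->|_]; rewrite mxE ?normr0 // normrM ger0_norm //.
  by rewrite ler_piMr // normr_sg; case: (_ != 0).
have := H A g UA Ug i; rewrite dotvD /g eqxx lerBrDr; apply: le_trans.
rewrite lerD2l [leRHS]dotvE mulr_sumr; apply: ler_sum => l _.
by rewrite mxE mulrCA -[h i l 0 * _]mulrC -normrEsg.
Qed.

End Reformulation.

(** * The polyhedron of consistent matrices and its dual description *)

Section Uncertainty.
Variables (R : realType) (n s k : nat).
Variables (V : 'I_s -> 'M[R]_n) (v : 'I_s -> R) (p : pexp) (gamma : R) (d : nat).
Variables (xs ys : 'I_k -> 'cV[R]_n).

(* [UkA] as a system of scalar inequalities on the entries of the matrix: the
   [inl] rows are the prior constraints, and [inr (j, l, sg)] is the upper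
   ([sg = false]) or lower ([sg = true]) bound on entry [l] of the [j]-th
   residual. *)
Definition UkA_lhs (j : 'I_s + 'I_k * 'I_n * bool) (t : 'I_n * 'I_n) : R :=
  match j with
  | inl j => V j t.1 t.2
  | inr (j, l, sg) => (-1) ^+ sg * ((t.1 == l)%:R * xs j t.2 0)
  end.

Definition UkA_rhs (j : 'I_s + 'I_k * 'I_n * bool) : R :=
  match j with
  | inl j => v j
  | inr (j, l, sg) => (-1) ^+ sg * ys j l 0 + gamma * norm_p p (xs j) ^+ d
  end.

Lemma pairing_mxE (a : 'I_n * 'I_n -> R) (A : 'M[R]_n) :
  pairing a (fun t => A t.1 t.2) = \sum_i \sum_j a (i, j) * A i j.
Proof. by rewrite pair_bigA; apply: eq_bigr => -[]. Qed.

Lemma UkAP (A : 'M[R]_n) : 0 <= gamma -> UkA V v p gamma d xs ys A <->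
  forall j, pairing (UkA_lhs j) (fun t => A t.1 t.2) <= UkA_rhs j.
Proof.
move=> gamma0.
have trE j : pairing (UkA_lhs (inl j)) (fun t => A t.1 t.2) = \tr ((V j)^T *m A).
  rewrite pairing_mxE exchange_big /mxtrace; apply: eq_bigr => l _.
  by rewrite mxE; apply: eq_bigr => i _; rewrite mxE.
have resE j l sg : pairing (UkA_lhs (inr (j, l, sg))) (fun t => A t.1 t.2) =
    (-1) ^+ sg * (A *m xs j) l 0.
  rewrite pairing_mxE (bigD1 l) //= [X in _ + X]big1 => [|i /negbTE il].
    rewrite addr0 mxE mulr_sumr; apply: eq_bigr => i _; rewrite eqxx /=; ring.
  by rewrite big1 // => j' _; rewrite il mul0r mulr0 mul0r.
split=> [[UA res] [j|[[j l] sg]]|H].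
- by rewrite trE.
- rewrite resE /=; have /norm_inf_leP[_ /(_ l)] := res j.
  rewrite !mxE ler_norml => /andP[].
  by case: sg; rewrite ?expr1 ?expr0 ?mulN1r ?mul1r; lra.
split=> [j|j]; first by rewrite -trE; apply: H.
(* The maximum defining [norm_inf] starts from [0], so the radius must itself be shown
   nonnegative. *)
apply/norm_inf_leP; split.
  by rewrite mulr_ge0 // exprn_ge0 // norm_p_ge0.
move=> l; have := H (inr (j, l, true)); have := H (inr (j, l, false)).
rewrite !resE /= !mxE expr1 expr0 ler_norml !mulN1r !mul1r => ? ?.
by apply/andP; split; lra.
Qed.

(** For fixed [x], [dotv h (A *m x)] is linear in [A] with coefficient matrix [h x^T], so duality
    applies. The resulting conditions are jointly linear in [x] and [l], unlike the products of [A]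
    and [x]. *)
Lemma UkA_dotv_leP (A0 : 'M[R]_n) (h x : 'cV[R]_n) (beta : R) :
  0 <= gamma -> UkA V v p gamma d xs ys A0 ->
  (forall A, UkA V v p gamma d xs ys A -> dotv h (A *m x) <= beta) <->
  exists l, [/\ forall j, 0 <= l j,
    forall t, h t.1 0 * x t.2 0 = \sum_j l j * UkA_lhs j t
    & \sum_j l j * UkA_rhs j <= beta].
Proof.
move=> gamma0 /UkAP-/(_ gamma0) UA0.
rewrite -(lp_duality (fun t => h t.1 0 * x t.2 0) beta UA0).
have dotE A : dotv h (A *m x) =
    pairing (fun t => h t.1 0 * x t.2 0) (fun t => A t.1 t.2).
  rewrite pairing_mxE dotvE; apply: eq_bigr => i _.
  by rewrite mxE mulr_sumr; apply: eq_bigr => j _ /=; ring.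
split=> H A UA; last by rewrite dotE; apply: H; apply/UkAP.
have AE : A = fun t => (\matrix_(i, j) A (i, j)) t.1 t.2.
  by apply/funext => -[i j]; rewrite mxE.
by rewrite AE -dotE; apply: H; apply/UkAP => // j; rewrite -AE.
Qed.

End Uncertainty.

(** * Representability of the robust feasible set and the final program *)

Lemma soc_rep_polyS (R : realType) n r (h : 'I_r -> 'cV[R]_n) (b : 'I_r -> R) :
  soc_rep (fun x : 'I_n -> R => polyS h b (\col_i x i)).
Proof.
apply: soc_rep_forall => i; apply: soc_rep_le (affine_const _ _).
under eq_fun do rewrite dotvE.
apply: affine_sum => j; apply: affineZ.
under eq_fun do rewrite mxE.
exact: affine_proj.
Qed.

(** Emptiness of [UkA] does not depend on [x], so the case split may precede the construction of the
    cones; the nonempty case supplies the base point for duality. *)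
Lemma soc_rep_robust_feasible (R : realType) (n r s k : nat)
    (h : 'I_r -> 'cV[R]_n) (b : 'I_r -> R)
    (V : 'I_s -> 'M[R]_n) (v : 'I_s -> R) (p : pexp) (gamma : R) (d : nat)
    (xs ys : 'I_k -> 'cV[R]_n) : pexp_ok p -> 0 <= gamma ->
  soc_rep (fun x : 'I_n -> R =>
    robust_feasible h b V v p gamma d xs ys (\col_i x i)).
Proof.
move=> p_ok gamma0.
case: (pselect (exists A, UkA V v p gamma d xs ys A)) => [[A0 UA0]|noA]; last first.
  apply: soc_rep_iff (soc_rep_polyS h b) => x; split=> [Sx|[]//].
  by split=> // A g UA; case: noA; exists A.
pose lhs := UkA_lhs V xs; pose rhs := UkA_rhs v p gamma d xs ys.
pose H i := \sum_l `|h i l 0|.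
(* [u true] bounds [norm_p p x] and [u false] bounds its [d]-th power. *)
pose Q x (u : bool -> R) := norm_p p (\col_i x i) <= u true /\
  ([/\ 0 <= u true, 0 <= u false & u true ^+ d <= u false] /\
   forall i, exists l, (forall j, 0 <= l j) /\
    ((forall t, h i t.1 0 * x t.2 = \sum_j l j * lhs j t) /\
     \sum_j l j * rhs j <= b i - gamma * u false * H i)).
have rQ : soc_rep (fun x : 'I_n -> R => exists u, Q x u).
  apply: soc_rep_exists; apply: soc_rep_and.
    by apply: (soc_rep_norm_p (f := fun i z => z (inl i))) => // *;
      exact: affine_proj.
  apply: soc_rep_and; first by apply: soc_rep_power; exact: affine_proj.
  apply: soc_rep_forall => i; apply: soc_rep_exists.
  apply: soc_rep_and.
    apply: soc_rep_forall => j.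
    by apply: soc_rep_le; [exact: affine_const|exact: affine_proj].
  apply: soc_rep_and.
    apply: soc_rep_forall => t; apply: soc_rep_eq.
      by apply: affineZ; exact: affine_proj.
    by apply: affine_sum => j; apply: affineZr; exact: affine_proj.
  apply: soc_rep_le.
    by apply: affine_sum => j; apply: affineZr; exact: affine_proj.
  apply: affineB; first exact: affine_const.
  by apply: affineZr; apply: affineZ; exact: affine_proj.
apply: soc_rep_iff (soc_rep_and (soc_rep_polyS h b) rQ) => x.
have colE : forall j, (\col_i x i) j 0 = x j by move=> j; rewrite mxE.
have H0 i : 0 <= H i by apply: sumr_ge0.
rewrite robust_feasibleP //; split.
  move=> [Sx [u [xu [[u0 u1 ud] Hl]]]]; split=> // i.
  apply/(UkA_dotv_leP (h i) (\col_i x i) _ gamma0 UA0).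
  have [l [l0 [lE lb]]] := Hl i; exists l; split=> //.
    by move=> t; rewrite colE lE.
  apply: le_trans lb _; rewrite lerD2l lerN2 ler_wpM2r ?H0 //.
  rewrite ler_wpM2l //; apply: le_trans ud.
  by apply: lerXn2r; rewrite ?nnegrE ?norm_p_ge0.
move=> [Sx HA]; split=> //.
pose t := norm_p p (\col_i x i).
(* Conversely, both bounds are taken tight. *)
exists (fun c => if c then t else t ^+ d); rewrite /Q lexx; split=> //; split.
  by split; rewrite ?exprn_ge0 ?norm_p_ge0.
move=> i; have /(UkA_dotv_leP (h i) (\col_i x i) _ gamma0 UA0)[l [l0 lE lb]] := HA i.
by exists l; split=> //; split=> // tt; rewrite -lE colE.
Qed.

Theorem theorem24 (R : realType) (n r s k : nat)
  (h : 'I_r -> 'cV[R]_n) (b : 'I_r -> R)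
  (V : 'I_s -> 'M[R]_n) (v : 'I_s -> R)
  (p : pexp) (gamma : R) (d : nat)
  (Astar : 'M[R]_n) (gstar : 'cV[R]_n -> 'cV[R]_n)
  (xs ys : 'I_k -> 'cV[R]_n) (c : 'cV[R]_n) :
  pexp_ok p -> 0 < gamma ->
  U0A V v Astar -> U0g h b p gamma d gstar ->
  (forall j, ys j = Astar *m xs j + gstar (xs j)) ->
  exists (N : nat) (P : socp R (n + N)),
    socp_reformulation c (robust_feasible h b V v p gamma d xs ys) P.
Proof.
move=> p_ok gamma0 _ _ _.
have [N [P [Pc PE]]] := soc_rep_socp c
  (soc_rep_robust_feasible h b V v d xs ys p_ok (ltW gamma0)).
exists N, P; split=> // x; rewrite -PE.
suff -> : \col_i x i 0 = x by [].
by apply/colP => i; rewrite mxE.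
Qed.
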